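(* Let $n$ be odd and let $C=(C_0,C_1,\ldots,C_{k-1})$ be an equitable $k$-partition of the halved $n$-cube $\frac12 H(n)$ (whose vertices are the even-weight binary words of length $n$). For each $i$, let $C_i' = C_i\cup(C_i+\bar 1)$, where $\bar 1$ is the all-ones word and $C_i+\bar 1=\{\bar x+\bar 1:\bar x\in C_i\}$. Then $C'=(C'_0,\ldots,C'_{k-1})$ is an equitable $k$-partition of the $n$-cube $H(n)$.
   Context: The $n$-cube $H(n)$ is the graph on all binary words of length $n$ (vectors over GF$(2)$), two words adjacent iff they differ in exactly one position. The halved $n$-cube $\frac12 H(n)$ is the graph on the binary words of length $n$ with an even number of ones, two words adjacent iff they differ in exactly two positions. An equitable $k$-partition of a graph is an ordered partition $(C_0,\ldots,C_{k-1})$ of its vertex set (into cells) such that for all $i,j$ the number of neighbors in $C_j$ of a vertex of $C_i$ is a constant $S_{ij}$ not depending on the chosen vertex; $S=(S_{ij})$ is the quotient matrix. *)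

(* Defs.v *)
From mathcomp Require Import all_boot all_order all_algebra.

Set Implicit Arguments.
Unset Strict Implicit.
Unset Printing Implicit Defensive.

Import GRing.Theory.

Local Open Scope ring_scope.

(* A finite graph is given by a vertex set [V : {set T}] inside a finite type
   [T] together with an adjacency relation [e] on [T], which only matters on
   [V]. *)

Section EquitablePartition.

Variables (T : finType) (V : {set T}) (e : rel T) (k : nat).

(* As usual for partitions, cells are nonempty; this is also what makes the
   quotient matrix unique. *)
Definition ordered_partition (C : 'I_k -> {set T}) : Prop :=
  [/\ forall i, C i != set0,
      forall i j, i != j -> [disjoint C i & C j]
    & \bigcup_(i < k) C i = V].

Definition quotient_matrix (C : 'I_k -> {set T}) (S : 'M[nat]_k) : Prop :=
  forall (i j : 'I_k) (x : T), x \in C i -> #|[set y in C j | e x y]| = S i j.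

Definition equitable_partition (C : 'I_k -> {set T}) : Prop :=
  ordered_partition C /\ exists S : 'M[nat]_k, quotient_matrix C S.

End EquitablePartition.

Section Cubes.

Variable n : nat.

Definition word := 'rV['F_2]_n.

Definition ones : word := const_mx 1.

Definition weight (x : word) : nat := #|[set i | x 0 i == 1]|.

Definition hamming (x y : word) : nat := #|[set i | x 0 i != y 0 i]|.

Definition cube_vertices : {set word} := [set: word].

Definition cube_adj : rel word := fun x y => hamming x y == 1%N.

Definition halved_cube_vertices : {set word} := [set x | ~~ odd (weight x)].

Definition halved_cube_adj : rel word := fun x y => hamming x y == 2%N.

Definition antipodal_closure (A : {set word}) : {set word} :=
  A :|: [set x + ones | x in A].

End Cubes.

Arguments ones {n}.

(* Main.v *)
(** Let [N_m f x] be the sum of [f] over the sphere of radius [m] around [x]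
    in the [n]-cube, and let [D = N_1].  The three-term recurrence
    [D N_(m+1) = (m+2) N_(m+2) + (n-m) N_m] shows that [D D = 2 N_2 + n] and
    hence, by induction on even [m], that [N_m] is a polynomial in [N_2].
    Since [N_2] is the adjacency operator of the halved cube, each [N_m] with
    [m] even preserves the functions that are constant on the cells of an
    equitable partition.  When [n] is odd this applies to [m = n - 1], and a
    word [y + 1] is adjacent to [x] in the cube exactly when [y] is at
    distance [n - 1] from [x]. *)

Require Import Defs.
From mathcomp Require Import all_boot all_order all_algebra.
From mathcomp Require Import zify.

Set Implicit Arguments.
Unset Strict Implicit.
Unset Printing Implicit Defensive.

Import GRing.Theory.
Local Open Scope ring_scope.

(** * Weights and distances of binary words *)

Lemma F2_neq1 (a : 'F_2) : (a != 1) = (a == 0).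
Proof. by case: a => -[|[|//]]. Qed.

Lemma F2_addaa (a : 'F_2) : a + a = 0.
Proof. by apply/eqP; case: a => -[|[|//]]. Qed.

Section Weight.

Variable n : nat.
Implicit Types x y z : word n.

Lemma word_addxx x : x + x = 0.
Proof. by apply/rowP => i; rewrite !mxE F2_addaa. Qed.

Lemma word_addK z : cancel (fun x => x + z) (fun x => x + z).
Proof. by move=> x; rewrite -addrA word_addxx addr0. Qed.

Lemma hammingE x y : hamming x y = weight (x + y).
Proof.
apply: eq_card => i; rewrite !inE mxE.
by case: (x 0 i) => -[|[|//]] ?; case: (y 0 i) => -[|[|//]] ?.
Qed.

Lemma weight_le x : (weight x <= n)%N.
Proof. by rewrite -[leqRHS]card_ord max_card. Qed.

Lemma weight_eq0 x : (weight x == 0%N) = (x == 0).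
Proof.
rewrite cards_eq0; apply/eqP/eqP => [w0|->]; last first.
  by apply/setP => i; rewrite !inE mxE.
apply/rowP => i; move/setP/(_ i): w0; rewrite !inE mxE => /negbT.
by rewrite F2_neq1 => /eqP.
Qed.

Lemma weight_sum x : (weight x)%:R = \sum_i x 0 i.
Proof.
rewrite /weight cardsE -sum1_card natr_sum big_mkcond /=.
by apply: eq_bigr => i _; rewrite unfold_in; case: (x 0 i) => -[|[|//]] ? /=;
  apply/eqP.
Qed.

(** Read in ['F_2], the weight is the sum of the entries, and that sum is additive. *)
Lemma odd_weightD x y : odd (weight (x + y)) = odd (weight x) (+) odd (weight y).
Proof.
have oddF2 m : odd m = (m%:R == 1 :> 'F_2).
  by rewrite -val_eqE /= val_Fp_nat // modn2; case: odd.
rewrite -oddD !oddF2 natrD !weight_sum -big_split /=.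
by congr (_ == _); apply: eq_bigr => i _; rewrite mxE.
Qed.

Lemma odd_hamming x y : odd (hamming x y) = odd (weight x) (+) odd (weight y).
Proof. by rewrite hammingE odd_weightD. Qed.

Lemma weight_addones x : weight (x + ones) = (n - weight x)%N.
Proof.
transitivity #|~: [set i | x 0 i == 1]|; last by rewrite cardsCs setCK card_ord.
apply: eq_card => i.
by rewrite !inE !mxE; case: (x 0 i) => -[|[|//]].
Qed.

Lemma weight_flip x t :
  weight (x + delta_mx 0 t) = if x 0 t == 1 then (weight x).-1 else (weight x).+1.
Proof.
pose A := [set i | x 0 i == 1].
have tA : (t \in A) = (x 0 t == 1) by rewrite inE.
case: ifPn; rewrite -tA => xt.
  rewrite /weight (cardsD1 t A) xt /=; apply: eq_card => i.
  rewrite !inE !mxE eqxx /=; case: (eqVneq i t) => [->|_]; last by rewrite addr0.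
  by move: xt; rewrite inE => /eqP->; apply/eqP.
have -> : (weight x).+1 = #|t |: A| by rewrite cardsU1 xt.
apply: eq_card => i; rewrite !inE !mxE eqxx /=.
case: (eqVneq i t) => [->|_]; last by rewrite addr0.
by move: xt; rewrite inE F2_neq1 => /eqP->; rewrite add0r.
Qed.

(** Flipping a one lowers the weight and flipping a zero raises it, so the two terms count the ones
    and the zeros of [x]. The Boolean factors select the relevant case; at most one of them is
    nonzero. *)
Lemma card_weight_flip x m :
  #|[set t | weight (x + delta_mx 0 t) == m]|
    = ((weight x == m.+1) * m.+1 + ((weight x).+1 == m) * (n - weight x))%N.
Proof.
pose A := [set i | x 0 i == 1].
have cA : #|A| = weight x by [].
have cAC : #|~: A| = (n - weight x)%N by rewrite cardsCs setCK card_ord.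
case: (eqVneq (weight x) m.+1) => [wx|wx].
  have -> : ((weight x).+1 == m) = false by rewrite wx; apply/negbTE/eqP; lia.
  rewrite mul1n addn0 -wx -cA; apply: eq_card => t.
  by rewrite !inE weight_flip; case: ifP => _; rewrite wx ?eqxx //=; lia.
rewrite mul0n add0n; case: (eqVneq (weight x).+1 m) => [wx'|wx'].
  rewrite mul1n -cAC; apply: eq_card => t.
  by rewrite !inE weight_flip; case: ifP => _; rewrite -wx' ?eqxx //=; lia.
apply: eq_card0 => t; rewrite !inE weight_flip; case: ifP => xt.
  apply/negbTE/eqP => wm; case/eqP: wx.
  (* A one at position [t] makes the weight positive, so [.-1] does not truncate. *)
  have : (0 < weight x)%N by rewrite card_gt0; apply/set0Pn; exists t; rewrite inE.
  lia.
exact/negbTE.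
Qed.

End Weight.

(** * Sphere sums and their recurrences *)

Section SphereSums.

Variable n : nat.
Implicit Types (f : word n -> nat) (x y z : word n).

Definition sphere_sum m f x : nat := (\sum_(y | hamming x y == m) f y)%N.

(** The operator [D], indexed by the flipped position rather than by the neighbour. *)
Definition flip_sum f x : nat := (\sum_t f (x + delta_mx 0 t)%R)%N.

(** Double counting: [f y] occurs once for each flip that brings [x] to distance [m] from [y], which
    requires distance [m + 1] or [m - 1] beforehand. The inner condition is written with a successor
    so that [m = 0] gives an empty sum. *)
Lemma flip_sum_sphere m f x :
  flip_sum (sphere_sum m f) x =
    (m.+1 * sphere_sum m.+1 f x
     + \sum_(y | (hamming x y).+1 == m) (n - hamming x y) * f y)%N.
Proof.
transitivity (\sum_y #|[set t | weight (x + y + delta_mx 0 t)%R == m]| * f y)%N.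
  rewrite /flip_sum /sphere_sum (exchange_big_dep predT) //=.
  apply: eq_bigr => y _; rewrite sum_nat_const; congr (_ * _)%N.
  by apply: eq_card => t; rewrite !inE unfold_in hammingE addrAC.
rewrite /sphere_sum big_distrr /= [X in (X + _)%N]big_mkcond.
rewrite [X in (_ + X)%N]big_mkcond -big_split /=.
apply: eq_bigr => y _; rewrite card_weight_flip -hammingE mulnDl.
by congr (_ + _)%N; case: eqP; rewrite ?mul0n ?mul1n.
Qed.

Lemma sphere_sum0 f x : sphere_sum 0 f x = f x.
Proof.
rewrite /sphere_sum (big_pred1 x) // => y /=.
rewrite hammingE weight_eq0 addrC -(word_addxx x).
exact: (inj_eq (can_inj (word_addK x))).
Qed.

Lemma flip_sum_sphere0 f x : flip_sum (sphere_sum 0 f) x = sphere_sum 1 f x.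
Proof. by rewrite flip_sum_sphere mul1n big_pred0 ?addn0. Qed.

Lemma flip_sum_sphereS m f x :
  flip_sum (sphere_sum m.+1 f) x =
    (m.+2 * sphere_sum m.+2 f x + (n - m) * sphere_sum m f x)%N.
Proof.
rewrite flip_sum_sphere; congr (_ + _)%N.
by rewrite /sphere_sum big_distrr; apply: eq_bigr => y /eqP[->].
Qed.

Lemma eq_flip_sum f g : f =1 g -> flip_sum f =1 flip_sum g.
Proof. by move=> fg x; apply: eq_bigr. Qed.

Lemma flip_sum_lin a b f g x :
  flip_sum (fun z => a * f z + b * g z)%N x = (a * flip_sum f x + b * flip_sum g x)%N.
Proof. by rewrite /flip_sum big_split !big_distrr. Qed.

Lemma flip_sum2 f x :
  flip_sum (flip_sum f) x = (2 * sphere_sum 2 f x + n * f x)%N.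
Proof.
rewrite -(sphere_sum0 f) -[n in RHS]subn0 -flip_sum_sphereS.
apply: eq_flip_sum => y; rewrite -flip_sum_sphere0.
by apply: eq_flip_sum => z; rewrite sphere_sum0.
Qed.

(** Two applications of the recurrence; only spheres whose radii have the parity of [m] appear. *)
Lemma flip_sum2_sphere m f x :
  flip_sum (flip_sum (sphere_sum m.+2 f)) x =
    (m.+3 * m.+4 * sphere_sum m.+4 f x
     + (m.+3 * (n - m.+2) + (n - m.+1) * m.+2) * sphere_sum m.+2 f x
     + (n - m.+1) * (n - m) * sphere_sum m f x)%N.
Proof.
rewrite (eq_flip_sum (flip_sum_sphereS _ _)) flip_sum_lin !flip_sum_sphereS.
move: (sphere_sum _ f x) (sphere_sum _ f x) (sphere_sum _ f x) => c b a.
move: (n - m)%N (n - m.+1)%N (n - m.+2)%N m.+2 m.+3 m.+4 => p q r u v w.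
by rewrite !mulnDr mulnDl !mulnA !addnA.
Qed.

End SphereSums.

(** * Functions constant on the cells *)

Section CellConstant.

Variables (n k : nat) (C : 'I_k -> {set word n}).
Hypothesis hC :
  equitable_partition (halved_cube_vertices n) (@halved_cube_adj n) C.
Implicit Types f : word n -> nat.

Definition cell_constant f :=
  forall i x y, x \in C i -> y \in C i -> f x = f y.

Lemma cell_even i x : x \in C i -> ~~ odd (weight x).
Proof.
case: hC => -[_ _ cov] _ xi.
have : x \in \bigcup_(i < k) C i by apply/bigcupP; exists i.
by rewrite cov inE.
Qed.

Lemma even_cell x : ~~ odd (weight x) -> exists i, x \in C i.
Proof.
case: hC => -[_ _ cov] _ xe.
have : x \in \bigcup_(i < k) C i by rewrite cov inE.
by case/bigcupP => i _ xi; exists i.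
Qed.

Lemma cell_inj i j x : x \in C i -> x \in C j -> i = j.
Proof.
case: hC => -[_ dis _] _ xi xj; apply/eqP/idPn => /dis/disjointFr/(_ xi).
by rewrite xj.
Qed.

(** On cell-constant functions, [N_2] acts as multiplication of the vector of cell values by the
    quotient matrix. *)
Lemma cell_constant_sphere2 f : cell_constant f -> cell_constant (sphere_sum 2 f).
Proof.
move=> fc i; case: hC => -[ne dis cov] [S hS].
pose v j := f (xchoose (set0Pn _ (ne j))).
suff val x : x \in C i -> sphere_sum 2 f x = (\sum_j S i j * v j)%N.
  by move=> x y /val-> /val->.
move=> xi; rewrite /sphere_sum.
(* Words at distance 2 from an even word are even, hence covered by the cells. *)
transitivity (\sum_(y in \bigcup_(j < k) C j | hamming x y == 2) f y)%N.
  apply: eq_bigl => y; rewrite cov inE; case: eqP => [dxy|]; last by rewrite andbF.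
  have := odd_hamming x y; rewrite dxy (negbTE (cell_even xi)) /= => <-.
  by [].
rewrite big_mkcondr partition_disjoint_bigcup //=; apply: eq_bigr => j _.
rewrite -big_mkcondr -(hS i j x xi) -sum_nat_const.
apply: eq_big => [y|y /andP[yj _]]; first by rewrite inE.
exact: fc yj (xchooseP (set0Pn _ (ne j))).
Qed.

Lemma cell_constant_flip2 f :
  cell_constant f -> cell_constant (flip_sum (flip_sum f)).
Proof.
move=> fc i x y xi yi; rewrite !flip_sum2 (fc i x y xi yi).
by rewrite (cell_constant_sphere2 fc xi yi).
Qed.

Lemma cell_constant_sphere m f :
  ~~ odd m -> cell_constant f -> cell_constant (sphere_sum m f).
Proof.
move=> m_even fc; rewrite -(even_halfK m_even); elim/ltn_ind: {m m_even}(m./2).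
case=> [|[|m]] IH; first by move=> i x y xi yi; rewrite !sphere_sum0; apply: fc yi.
  exact: cell_constant_sphere2.
move=> i x y xi yi.
have c0 := IH m (leqnSn _) i x y xi yi.
have c2 := IH m.+1 (leqnn _).
have := cell_constant_flip2 c2 xi yi.
rewrite !doubleS !flip_sum2_sphere -!doubleS c0 (c2 _ _ _ xi yi).
(* The lower terms agree at [x] and [y] and cancel; the leading coefficient is positive and cancels
   too. *)
by move=> /addIn/addIn/eqP; rewrite eqn_pmul2l // => /eqP.
Qed.

End CellConstant.

(** * Neighbours in antipodal closures *)

Section AntipodalClosure.

Variables (n : nat).
Implicit Types (A : {set word n}) (x y : word n).

Lemma mem_antipodal_closure A x :
  (x \in antipodal_closure A) = (x \in A) || (x + ones \in A).
Proof.
rewrite inE; congr (_ || _).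
apply/imsetP/idP => [[y yA ->]|xA]; first by rewrite word_addK.
by exists (x + ones); rewrite ?word_addK.
Qed.

Lemma antipodal_closure_addones A x :
  (x + ones \in antipodal_closure A) = (x \in antipodal_closure A).
Proof. by rewrite !mem_antipodal_closure word_addK orbC. Qed.

(** Translation by [ones] preserves distances and maps the closure onto itself. *)
Lemma card_cube_nbrs_addones A x :
  #|[set y in antipodal_closure A | cube_adj (x + ones) y]|
    = #|[set y in antipodal_closure A | cube_adj x y]|.
Proof.
rewrite -(card_imset _ (can_inj (word_addK ones))); apply: eq_card => y.
rewrite (can2_imset_pre _ (word_addK ones) (word_addK ones)).
rewrite [LHS]in_set [LHS]in_set [RHS]in_set.
rewrite antipodal_closure_addones /cube_adj !hammingE.
by rewrite [y + ones]addrC addrA word_addK.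
Qed.

(** Cube neighbours of an even word are odd, so those in the closure are translates [y + ones] with
    [y] in [A], and these are at distance [n - hamming x y]. *)
Lemma card_cube_nbrs_closure A x :
    odd n -> {in A, forall y, ~~ odd (weight y)} -> ~~ odd (weight x) ->
  #|[set y in antipodal_closure A | cube_adj x y]|
    = #|[set y in A | hamming x y == n.-1]|.
Proof.
move=> n_odd A_even x_even.
rewrite -(card_imset [set y in A | _] (can_inj (word_addK ones))).
apply: eq_card => y.
rewrite (can2_imset_pre _ (word_addK ones) (word_addK ones)).
rewrite [LHS]in_set [RHS]in_set [RHS]in_set mem_antipodal_closure /cube_adj.
have -> : hamming x (y + ones) = (n - hamming x y)%N.
  by rewrite !hammingE addrA weight_addones.
have le_n : (hamming x y <= n)%N by rewrite hammingE weight_le.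
(* Oddness of [n] gives [n > 0]; the equivalence fails at [n = 0]. *)
have -> : (n - hamming x y == n.-1)%N = (hamming x y == 1%N) by lia.
case: eqP => [d1|]; rewrite ?andbF // !andbT.
suff /negbTE-> : y \notin A by [].
apply/negP => /A_even; have := odd_hamming x y.
by rewrite d1 (negbTE x_even) => /= <-.
Qed.

End AntipodalClosure.

(** * Equitability of the closed partition *)

Theorem theorem1 (n k : nat) (C : 'I_k -> {set word n}) (hn : odd n)
    (hC : equitable_partition (halved_cube_vertices n) (@halved_cube_adj n) C) :
  equitable_partition (cube_vertices n) (@cube_adj n)
    (fun i : 'I_k => antipodal_closure (C i)).
Proof.
have [[ne _ _] _] := hC.
(* As [n] is odd, translation by [ones] swaps even and odd words. This separates cells from
   translated cells and makes the closures cover the cube. *)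
have odd_addones (x : word n) : odd (weight (x + ones)) = ~~ odd (weight x).
  by rewrite weight_addones oddB ?weight_le // hn.
split; first split.
- by move=> i; have /set0Pn[x xi] := ne i; apply/set0Pn; exists x; rewrite inE xi.
- move=> i j neq_ij; rewrite disjoints_subset; apply/subsetP => x.
  rewrite in_setC !mem_antipodal_closure.
  move=> xi; apply/negP => xj; case/eqP: neq_ij.
  case/orP: xi => xi; case/orP: xj => xj; try exact: (cell_inj hC xi xj).
    by have := cell_even hC xj; rewrite odd_addones (cell_even hC xi).
  by have := cell_even hC xi; rewrite odd_addones (cell_even hC xj).
- apply/setP => x; rewrite in_setT; apply/bigcupP.
  case: (boolP (odd (weight x))) => [xo|xe].
    have /(even_cell hC)[i xi] : ~~ odd (weight (x + ones)) by rewrite odd_addones xo.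
    by exists i; rewrite // mem_antipodal_closure xi orbT.
  have [i xi] := even_cell hC xe.
  by exists i; rewrite // mem_antipodal_closure xi.
(* The matrix entries are read off at a representative of each cell. *)
pose r i := xchoose (set0Pn _ (ne i)).
have rP i : r i \in C i := xchooseP (set0Pn _ (ne i)).
exists (\matrix_(i, j) #|[set y in antipodal_closure (C j) | cube_adj (r i) y]|).
move=> i j x; rewrite mxE mem_antipodal_closure.
(* Either [x] or [x + ones] lies in [C i], and both have the same neighbour counts. *)
wlog xi : x / x \in C i => [wlog_x|_].
  case/orP => xi; first by apply: wlog_x; rewrite ?xi.
  by rewrite -card_cube_nbrs_addones; apply: wlog_x; rewrite ?xi.
rewrite !card_cube_nbrs_closure ?(cell_even hC (rP i)) ?(cell_even hC xi) //;
  try by move=> y; apply: cell_even.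
(* The neighbour count is now [N_(n-1)] of the indicator of [C j], and [n - 1] is even. *)
pose f (y : word n) : nat := y \in C j.
have fc : cell_constant C f.
  move=> l y z yl zl; congr nat_of_bool.
  apply/idP/idP => [yj|zj]; first by rewrite -(cell_inj hC yl yj).
  by rewrite -(cell_inj hC zl zj).
have sphereE y : sphere_sum n.-1 f y = #|[set z in C j | hamming y z == n.-1]|.
  rewrite /sphere_sum -sum1_card [LHS]big_mkcond [RHS]big_mkcond /=.
  by apply: eq_bigr => z _; rewrite inE andbC; case: ifP => //= _; case: (z \in _).
rewrite -!sphereE; apply: (cell_constant_sphere hC _ fc xi (rP i)).
by case: (n) hn.
Qed.
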